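(* Let $S$ be a finite set and $\Gamma=\bigsqcup_i\Gamma_i$ a directed $S$-labelled graph satisfying the $C'(1/6)$ graphical small cancellation condition, where each $\Gamma_i$ is finite and there exists $\delta>0$ with $g(\Gamma_i)\ge\delta\,\mathrm{diam}(\Gamma_i)$ for all $i$. Let $X$ be the Cayley graph of $G(\Gamma)=\langle S\mid\Gamma\rangle$ with respect to $S\sqcup S^{-1}$ and $e$ the identity. Then for each Morse gauge $N$ there is a finite subgraph $\Gamma_N\subset\Gamma$ and an isometric embedding $X^{(N)}_e\hookrightarrow X_N$, where $X_N$ is the Cayley graph of $\langle S\mid\Gamma_N\rangle$ with respect to $S\sqcup S^{-1}$.
   Context: A piece of a directed edge-labelled graph $\Gamma$ is a labelled path admitting two distinct label-preserving graph homomorphisms into $\Gamma$; $\Gamma$ satisfies $C'(1/6)$ if every piece contained in a simple closed path $C$ of $\Gamma$ has length $<|C|/6$. For a labelled graph $\Delta$, $\langle S\mid\Delta\rangle$ is the quotient of the free group on $S$ by the normal subgroup generated by the labels of closed paths (equivalently simple cycles) in $\Delta$. The girth $g(\Gamma_i)$ is the length of a shortest simple cycle of positive length. A Morse gauge is a function $N$ assigning to each $(K,C)$ a number $N(K,C)\ge0$; a geodesic is $N$-Morse if every $(K,C)$-quasi-geodesic with endpoints on it lies in its $N(K,C)$-neighbourhood. $X^{(N)}_e$ is the set of vertices... more precisely the set of points of $X$ joined to $e$ by an $N$-Morse geodesic, with the metric restricted from $X$. *)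

(* Defs.v *)
From Stdlib Require Import Reals List Lra.
From Coquelicot Require Import Coquelicot.
Import ListNotations.
Set Implicit Arguments.
Open Scope R_scope.

Record LGraph (S : Type) := {
  gV : Type; gE : Type;
  gsrc : gE -> gV; gtgt : gE -> gV; glab : gE -> S }.
Arguments gV {S}. Arguments gE {S}.
Arguments gsrc {S} _ _. Arguments gtgt {S} _ _. Arguments glab {S} _ _.

Definition FiniteT (T : Type) : Prop := exists l : list T, forall x, In x l.

Definition union {S I : Type} (G : I -> LGraph S) : LGraph S := {|
  gV := {i : I & gV (G i)};
  gE := {i : I & gE (G i)};
  gsrc := fun e => existT _ (projT1 e) (gsrc (G (projT1 e)) (projT2 e));
  gtgt := fun e => existT _ (projT1 e) (gtgt (G (projT1 e)) (projT2 e));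
  glab := fun e => glab (G (projT1 e)) (projT2 e) |}.

(** A step of a path is an edge together with an orientation
    ([true] = traversed along its direction, [false] = against it). *)
Definition step_start {S} (G : LGraph S) (st : gE G * bool) : gV G :=
  if snd st then gsrc G (fst st) else gtgt G (fst st).
Definition step_end {S} (G : LGraph S) (st : gE G * bool) : gV G :=
  if snd st then gtgt G (fst st) else gsrc G (fst st).

Fixpoint is_path {S} (G : LGraph S) (v w : gV G) (p : list (gE G * bool)) : Prop :=
  match p with
  | [] => v = w
  | st :: p' => step_start G st = v /\ is_path G (step_end G st) w p'
  end.

(** Letters of S ⊔ S^{-1}: (s,true) = s, (s,false) = s^{-1}. *)
Definition word (S : Type) := list (S * bool).

Definition plabel {S} (G : LGraph S) (p : list (gE G * bool)) : word S :=
  map (fun st => (glab G (fst st), snd st)) p.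

Definition simple_cycle {S} (G : LGraph S) (v : gV G) (c : list (gE G * bool)) : Prop :=
  is_path G v v c /\ c <> [] /\ NoDup (map fst c) /\ NoDup (map (step_start G) c).

(** [p], starting at [u], is a subpath of the closed path [c] based at [v]
    (subpaths may wrap around the base point). *)
Definition subpath_of_cycle {S} (G : LGraph S) (v : gV G) (c : list (gE G * bool))
  (u : gV G) (p : list (gE G * bool)) : Prop :=
  exists a b t, c = a ++ b /\ is_path G v u a /\ b ++ a = p ++ t.

(** A piece: a labelled path admitting two distinct label-preserving
    homomorphisms into G, i.e. two distinct paths of G with the same label. *)
Definition is_piece {S} (G : LGraph S) (u : gV G) (p : list (gE G * bool)) : Prop :=
  (exists w, is_path G u w p) /\
  exists u' w' p', is_path G u' w' p' /\ plabel G p' = plabel G p /\ (u, p) <> (u', p').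

Definition C'16 {S} (G : LGraph S) : Prop :=
  forall v c, simple_cycle G v c ->
  forall u p, subpath_of_cycle G v c u p -> is_piece G u p ->
  (6 * length p < length c)%nat.

Definition connected {S} (G : LGraph S) : Prop :=
  forall u v, exists p, is_path G u v p.

Definition gdist {S} (G : LGraph S) (u v : gV G) (n : nat) : Prop :=
  (exists p, is_path G u v p /\ length p = n) /\
  forall p, is_path G u v p -> (n <= length p)%nat.

Definition is_diam {S} (G : LGraph S) (D : nat) : Prop :=
  (forall u v n, gdist G u v n -> (n <= D)%nat) /\ exists u v, gdist G u v D.

Definition is_girth {S} (G : LGraph S) (g : nat) : Prop :=
  (exists v c, simple_cycle G v c /\ length c = g) /\
  forall v c, simple_cycle G v c -> (g <= length c)%nat.

Definition finite_subgraph {S} (G : LGraph S) (EP : gE G -> Prop) (VP : gV G -> Prop) : Prop :=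
  (exists le, forall e, EP e -> In e le) /\ (exists lv, forall v, VP v -> In v lv) /\
  (forall e, EP e -> VP (gsrc G e) /\ VP (gtgt G e)).

Definition relators {S} (G : LGraph S) (EP : gE G -> Prop) (r : word S) : Prop :=
  exists v p, is_path G v v p /\ List.Forall (fun st => EP (fst st)) p /\ r = plabel G p.

Definition linv {S} (x : S * bool) : S * bool := (fst x, negb (snd x)).

(** Equality in <S | R>: the congruence generated by free cancellation and
    relators (so that the quotient is F(S) / <<R>>). *)
Inductive weq {S} (Rel : word S -> Prop) : word S -> word S -> Prop :=
| weq_refl w : weq Rel w w
| weq_sym u v : weq Rel u v -> weq Rel v u
| weq_trans u v w : weq Rel u v -> weq Rel v w -> weq Rel u w
| weq_free u v x : weq Rel (u ++ x :: linv x :: v) (u ++ v)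
| weq_rel u v r : Rel r -> weq Rel (u ++ r ++ v) (u ++ v).

Definition vdist {S} (Rel : word S -> Prop) (u v : word S) : R :=
  real (Glb_Rbar (fun x => exists w, weq Rel (u ++ w) v /\ x = INR (length w))).

(** * Points of the Cayley graph as a metric graph.
    A point is a vertex g, or the interior point at parameter t in (0,1)
    of the edge from g to g s (s in S). Representatives are words; the
    distance below is a pseudometric identifying equal group elements. *)
Inductive Pt (S : Type) :=
| PV (g : word S)
| PE (g : word S) (s : S) (t : {t : R | 0 < t < 1}).
Arguments PV {S} g. Arguments PE {S} g s t.

Definition anchors {S} (p : Pt S) : list (word S * R) :=
  match p with
  | PV g => [(g, 0)]
  | PE g s t => [(g, proj1_sig t); (g ++ [(s, true)], 1 - proj1_sig t)]
  end.

Definition dX {S} (Rel : word S -> Prop) (p q : Pt S) : R :=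
  real (Glb_Rbar (fun r =>
    (exists a x b y, In (a, x) (anchors p) /\ In (b, y) (anchors q) /\
       r = x + vdist Rel a b + y) \/
    (exists g g' s t t', p = PE g s t /\ q = PE g' s t' /\ weq Rel g g' /\
       r = Rabs (proj1_sig t - proj1_sig t')))).

Definition geodesic {P} (d : P -> P -> R) (a b : R) (g : R -> P) : Prop :=
  a <= b /\ forall s t, a <= s <= b -> a <= t <= b -> d (g s) (g t) = Rabs (s - t).

Definition quasi_geodesic {P} (d : P -> P -> R) (K C : R) (a b : R) (q : R -> P) : Prop :=
  a <= b /\ forall s t, a <= s <= b -> a <= t <= b ->
    / K * Rabs (s - t) - C <= d (q s) (q t) <= K * Rabs (s - t) + C.

Definition morse_gauge (N : R -> R -> R) : Prop := forall K C, 0 <= N K C.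

Definition on_geodesic {P} (d : P -> P -> R) (a b : R) (g : R -> P) (x : P) : Prop :=
  exists s, a <= s <= b /\ d x (g s) = 0.

Definition N_Morse {P} (d : P -> P -> R) (N : R -> R -> R) (a b : R) (g : R -> P) : Prop :=
  forall K C, 1 <= K -> 0 <= C ->
  forall a' b' q, quasi_geodesic d K C a' b' q ->
    on_geodesic d a b g (q a') -> on_geodesic d a b g (q b') ->
    forall t, a' <= t <= b' -> exists s, a <= s <= b /\ d (q t) (g s) <= N K C.

Definition morse_stratum {P} (d : P -> P -> R) (N : R -> R -> R) (e : P) (x : P) : Prop :=
  exists a b g, geodesic d a b g /\ d (g a) e = 0 /\ d (g b) x = 0 /\ N_Morse d N a b g.

Definition isometric_embedding_on {P Q} (dP : P -> P -> R) (dQ : Q -> Q -> R)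
  (A : P -> Prop) (f : P -> Q) : Prop :=
  forall x y, A x -> A y -> dQ (f x) (f y) = dP x y.

(* Main.v *)
(** Let [x], [y] be joined to [e] by [N]-Morse geodesics, and let [q] be the
    point of a geodesic [[x,y]] closest to [e]. Then [[e,q]] followed by [[q,x]]
    is a (3,0)-quasi-geodesic, hence stays uniformly close to the Morse geodesic
    [[e,x]], and likewise for [y]. So the triangle [e,x,y] is filled by loops of
    length at most [M], with [M] depending only on [N], and its boundary label is
    a consequence of the relations of length at most [M]. As [S] is finite, these
    finitely many relations all follow from a finite subgraph. In the
    group it defines, geodesic words of points of the stratum therefore have the
    same distances as in [X]. *)

Require Import Defs.
From Stdlib Require Import Reals List Lra Lia Arith ClassicalEpsilon Classical.
From Coquelicot Require Import Coquelicot.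
Import ListNotations.
Open Scope R_scope.

(** * Group calculus on words and the word metric *)

Lemma linv_involutive {S} (x : S * bool) : linv (linv x) = x.
Proof. destruct x as [s b]; unfold linv; simpl; now rewrite Bool.negb_involutive. Qed.

Definition winv {S} (w : word S) : word S := rev (map linv w).

Lemma length_winv {S} (w : word S) : length (winv w) = length w.
Proof. unfold winv; now rewrite length_rev, length_map. Qed.

Lemma winv_involutive {S} (w : word S) : winv (winv w) = w.
Proof.
  unfold winv; rewrite map_rev, rev_involutive, map_map.
  erewrite map_ext; [apply map_id|apply linv_involutive].
Qed.

Section WordMetric.
Context {S : Type} (Rel : word S -> Prop).

Lemma weq_mult (a b : word S) {u v : word S} :
  weq Rel u v -> weq Rel (a ++ u ++ b) (a ++ v ++ b).
Proof.
  intros H; induction H.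
  - apply weq_refl.
  - now apply weq_sym.
  - eapply weq_trans; eauto.
  - generalize (weq_free Rel (a ++ u) (v ++ b) x).
    now rewrite <- !app_assoc; simpl.
  - generalize (weq_rel Rel (a ++ u) (v ++ b) r H).
    now rewrite <- !app_assoc; simpl.
Qed.

Lemma weq_appl (a : word S) {u v : word S} : weq Rel u v -> weq Rel (a ++ u) (a ++ v).
Proof. intros H; generalize (weq_mult a nil H); now rewrite !app_nil_r. Qed.

Lemma weq_appr (b : word S) {u v : word S} : weq Rel u v -> weq Rel (u ++ b) (v ++ b).
Proof. exact (weq_mult nil b). Qed.

Lemma weq_winvr (w : word S) : weq Rel (w ++ winv w) nil.
Proof.
  induction w as [|x w IH]; [apply weq_refl|].
  unfold winv; simpl; fold (winv w).
  apply weq_trans with ([x] ++ nil ++ [linv x]).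
  - generalize (weq_mult [x] [linv x] IH); now rewrite <- app_assoc.
  - exact (weq_free Rel nil nil x).
Qed.

Lemma weq_winvl (w : word S) : weq Rel (winv w ++ w) nil.
Proof. generalize (weq_winvr (winv w)); now rewrite winv_involutive. Qed.

Lemma weq_cancell (a : word S) {u v : word S} : weq Rel (a ++ u) (a ++ v) -> weq Rel u v.
Proof.
  assert (K : forall z, weq Rel (winv a ++ a ++ z) z).
  { intros z; rewrite app_assoc; apply (weq_appr z (weq_winvl a)). }
  intros H; eapply weq_trans; [apply weq_sym, K|].
  eapply weq_trans; [apply weq_appl, H|apply K].
Qed.

Lemma weq_cancelr (b : word S) {u v : word S} : weq Rel (u ++ b) (v ++ b) -> weq Rel u v.
Proof.
  assert (K : forall z, weq Rel ((z ++ b) ++ winv b) z).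
  { intros z; rewrite <- app_assoc.
    generalize (weq_appl z (weq_winvr b)); now rewrite app_nil_r. }
  intros H; eapply weq_trans; [apply weq_sym, K|].
  eapply weq_trans; [apply weq_appr, H|apply K].
Qed.

Lemma weq_app_winv (u v w : word S) : weq Rel (u ++ w) v -> weq Rel (v ++ winv w) u.
Proof.
  intros H; apply (weq_cancelr w); rewrite <- app_assoc.
  eapply weq_trans; [apply weq_appl, weq_winvl|].
  rewrite app_nil_r; now apply weq_sym.
Qed.

Lemma exists_short_word (u v : word S) :
  exists w, weq Rel (u ++ w) v /\
    forall w', weq Rel (u ++ w') v -> (length w <= length w')%nat.
Proof.
  assert (H : exists n w, weq Rel (u ++ w) v /\ length w = n).
  { exists (length (winv u ++ v)), (winv u ++ v); split; auto.
    rewrite app_assoc; exact (weq_appr v (weq_winvr u)). }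
  destruct (dec_inh_nat_subset_has_unique_least_element _ (fun n => classic _) H)
    as [n [[[w [Hw En]] Hmin] _]].
  exists w; split; auto.
  intros w' Hw'; rewrite En; apply Hmin; eauto.
Qed.

(** The choice is made per pair of words, so arguments equal in the group may receive different
    geodesic words. Compatibility with [weq] is argued separately wherever it matters. *)
Definition geo (u v : word S) : word S :=
  proj1_sig (constructive_indefinite_description _ (exists_short_word u v)).

Definition wdist (u v : word S) : nat := length (geo u v).

Lemma weq_geo (u v : word S) : weq Rel (u ++ geo u v) v.
Proof. unfold geo; destruct constructive_indefinite_description; simpl; tauto. Qed.

Lemma wdist_le (u v w : word S) : weq Rel (u ++ w) v -> (wdist u v <= length w)%nat.
Proof.
  unfold wdist, geo; destruct constructive_indefinite_description; simpl.
  destruct a; auto.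
Qed.

Lemma wdist_weq (u v : word S) : weq Rel u v -> wdist u v = 0%nat.
Proof.
  intros H; enough (wdist u v <= 0)%nat by lia.
  apply (wdist_le u v nil); now rewrite app_nil_r.
Qed.

Lemma wdist_sym (u v : word S) : wdist u v = wdist v u.
Proof.
  assert (K : forall a b, (wdist b a <= wdist a b)%nat).
  { intros a b; unfold wdist at 2; rewrite <- length_winv.
    apply wdist_le, weq_app_winv, weq_geo. }
  generalize (K u v) (K v u); lia.
Qed.

Lemma wdist_triangle (v u w : word S) : (wdist u w <= wdist u v + wdist v w)%nat.
Proof.
  unfold wdist at 2 3; rewrite <- length_app.
  apply wdist_le; rewrite app_assoc.
  eapply weq_trans; [apply weq_appr, weq_geo|apply weq_geo].
Qed.

Lemma wdist_letter (u : word S) (x : S * bool) : (wdist u (u ++ [x]) <= 1)%nat.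
Proof. exact (wdist_le u (u ++ [x]) [x] (weq_refl _ _)). Qed.

Lemma wdist_firstn (i j : nat) (s : word S) :
  (i <= j <= length s)%nat -> (wdist (firstn i s) (firstn j s) <= j - i)%nat.
Proof.
  intros H.
  assert (E : firstn j s = firstn i s ++ skipn i (firstn j s)).
  { rewrite <- (firstn_skipn i (firstn j s)) at 1.
    rewrite firstn_firstn, Nat.min_l; auto; lia. }
  replace (j - i)%nat with (length (skipn i (firstn j s))).
  - apply wdist_le; rewrite <- E; apply weq_refl.
  - rewrite length_skipn, length_firstn; lia.
Qed.

(** * Geodesic and quasi-geodesic words *)

Definition geodesic_from (u w : word S) : Prop := wdist u (u ++ w) = length w.

Lemma geodesic_from_geo (u v : word S) : geodesic_from u (geo u v).
Proof.
  unfold geodesic_from; apply Nat.le_antisymm.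
  - apply wdist_le, weq_refl.
  - fold (wdist u v); generalize (wdist_triangle (u ++ geo u v) u v).
    rewrite (wdist_weq _ _ (weq_geo u v)); lia.
Qed.

(** The three consecutive subwords bound the distances between their ends from above. These bounds
    add up to the distance between the outer ends, so each is attained. *)
Lemma geodesic_from_sub (u w : word S) (i j : nat) :
  geodesic_from u w -> (i <= j <= length w)%nat ->
  wdist (u ++ firstn i w) (u ++ firstn j w) = (j - i)%nat.
Proof.
  intros G H; unfold geodesic_from in G.
  assert (U : forall k l, (k <= l <= length w)%nat ->
     (wdist (u ++ firstn k w) (u ++ firstn l w) <= l - k)%nat).
  { intros k l Hkl.
    generalize (wdist_firstn (length u + k) (length u + l) (u ++ w)).
    rewrite !firstn_app_2, length_app; intros Q.
    replace (l - k)%nat with (length u + l - (length u + k))%nat by lia.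
    apply Q; lia. }
  generalize (U i j H) (U 0%nat i) (U j (length w)).
  rewrite firstn_all; simpl; rewrite app_nil_r.
  generalize (wdist_triangle (u ++ firstn i w) u (u ++ w))
    (wdist_triangle (u ++ firstn j w) (u ++ firstn i w) (u ++ w)); lia.
Qed.

Lemma geodesic_from_skipn (u w : word S) (i : nat) :
  geodesic_from u w -> geodesic_from (u ++ firstn i w) (skipn i w).
Proof.
  intros G; unfold geodesic_from.
  rewrite <- app_assoc, firstn_skipn, length_skipn.
  destruct (le_lt_dec i (length w)).
  - rewrite <- (geodesic_from_sub u w i (length w) G) by lia.
    now rewrite firstn_all.
  - rewrite firstn_all2 by lia; rewrite wdist_weq by apply weq_refl; lia.
Qed.

Lemma geodesic_from_firstn (u w : word S) (i : nat) :
  geodesic_from u w -> geodesic_from u (firstn i w).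
Proof.
  intros G; unfold geodesic_from.
  destruct (le_lt_dec i (length w)).
  - generalize (geodesic_from_sub u w 0 i G ltac:(lia)).
    rewrite length_firstn, Nat.min_l, Nat.sub_0_r by lia.
    simpl; now rewrite app_nil_r.
  - now rewrite firstn_all2 by lia.
Qed.

Lemma wdist_compat (u u' v v' : word S) :
  weq Rel u u' -> weq Rel v v' -> wdist u v = wdist u' v'.
Proof.
  intros Hu Hv; apply wdist_weq in Hu; apply wdist_weq in Hv.
  generalize (wdist_triangle u' u v) (wdist_triangle v' u' v)
    (wdist_triangle u u' v') (wdist_triangle v u v').
  rewrite (wdist_sym u' u), (wdist_sym v' v); lia.
Qed.

Lemma geodesic_from_winv (u w : word S) :
  geodesic_from u w -> geodesic_from (u ++ w) (winv w).
Proof.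
  unfold geodesic_from; intros G; rewrite length_winv, <- G, wdist_sym.
  apply wdist_compat; [apply weq_app_winv|]; apply weq_refl.
Qed.

(** Only the lower quasi-geodesic estimate is recorded, since [wdist_firstn] gives the upper one for
    every word. The additive term leaves room for one appended letter. *)
Definition quasi (s : word S) : Prop :=
  forall i j, (i <= j <= length s)%nat ->
    (j - i <= 3 * wdist (firstn i s) (firstn j s) + 6)%nat.

Lemma quasi_geodesic_word (z : word S) : geodesic_from nil z -> quasi z.
Proof.
  intros G i j H; generalize (geodesic_from_sub nil z i j G H); simpl; lia.
Qed.

Lemma quasi_geodesic_letter (z : word S) (x : S * bool) :
  geodesic_from nil z -> quasi (z ++ [x]).
Proof.
  intros G i j H; rewrite length_app in H; simpl in H.
  destruct (le_lt_dec j (length z)).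
  - rewrite !firstn_app.
    replace (i - length z)%nat with 0%nat by lia.
    replace (j - length z)%nat with 0%nat by lia.
    simpl; rewrite !app_nil_r; apply quasi_geodesic_word; auto; lia.
  - replace j with (length z + 1)%nat by lia.
    destruct (le_lt_dec i (length z)).
    + rewrite firstn_app_2, firstn_app.
      replace (i - length z)%nat with 0%nat by lia.
      simpl; rewrite !app_nil_r.
      generalize (geodesic_from_sub nil z i (length z) G); simpl.
      rewrite firstn_all.
      generalize (wdist_triangle (z ++ [x]) (firstn i z) z) (wdist_letter z x).
      rewrite (wdist_sym z (z ++ [x])); lia.
    + lia.
Qed.

(* With [p] on [z], [r] on [w], and [q] the turning point, [d e r >= d e q] gives
   [d p r >= d p q], hence [d q r <= 2 * d p r]. *)
Lemma quasi_closest (z w : word S) :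
  geodesic_from nil z -> geodesic_from z w ->
  (forall k, (k <= length w)%nat -> (length z <= wdist nil (z ++ firstn k w))%nat) ->
  quasi (z ++ w).
Proof.
  intros Gz Gw C i j H; rewrite length_app in H.
  destruct (le_lt_dec j (length z)) as [Hj|Hj].
  - rewrite !firstn_app.
    replace (i - length z)%nat with 0%nat by lia.
    replace (j - length z)%nat with 0%nat by lia.
    simpl; rewrite !app_nil_r; apply quasi_geodesic_word; auto; lia.
  - replace j with (length z + (j - length z))%nat by lia.
    set (l := (j - length z)%nat) in *; rewrite firstn_app_2.
    destruct (le_lt_dec i (length z)) as [Hi|Hi].
    + rewrite firstn_app.
      replace (i - length z)%nat with 0%nat by lia.
      simpl; rewrite app_nil_r.
      generalize (C l ltac:(lia)).
      generalize (geodesic_from_sub nil z i (length z) Gz ltac:(lia)).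
      generalize (geodesic_from_sub nil z 0 i Gz ltac:(lia)).
      generalize (geodesic_from_sub z w 0 l Gw ltac:(lia)); simpl.
      rewrite app_nil_r, firstn_all.
      generalize (wdist_triangle (firstn i z) z (z ++ firstn l w))
        (wdist_triangle (firstn i z) nil (z ++ firstn l w)).
      rewrite (wdist_sym z (firstn i z)); lia.
    + replace i with (length z + (i - length z))%nat by lia.
      rewrite firstn_app_2, geodesic_from_sub; auto; lia.
Qed.

(** The geodesic segments are chosen in the group of [Rel]. Read in another group on the same
    letters, the resulting words fix one coherent lift of the sequence [p], with which other words
    can be compared. *)
Fixpoint chain (p : nat -> word S) (k : nat) : word S :=
  match k with
  | O => geo nil (p O)
  | Datatypes.S k' => chain p k' ++ geo (p k') (p k)
  end.

Lemma weq_chain (p : nat -> word S) (k : nat) : weq Rel (chain p k) (p k).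
Proof.
  induction k; simpl.
  - exact (weq_geo nil (p 0%nat)).
  - eapply weq_trans; [apply weq_appr, IHk|apply weq_geo].
Qed.

Lemma chain_split (p : nat -> word S) (K k l : nat) :
  (forall k, (k < K)%nat -> (wdist (p k) (p (Datatypes.S k)) <= 3)%nat) ->
  (k <= l <= K)%nat ->
  exists m, chain p l = chain p k ++ m /\ (length m <= 3 * (l - k))%nat.
Proof.
  intros Hs; induction l as [|l IH]; intros H.
  - exists nil; replace k with 0%nat by lia; rewrite app_nil_r; simpl; split; auto; lia.
  - destruct (Nat.eq_dec k (Datatypes.S l)) as [->|Hne].
    + exists nil; rewrite app_nil_r; simpl; split; auto; lia.
    + destruct IH as [m [E Hm]]; [lia|].
      exists (m ++ geo (p l) (p (Datatypes.S l))); split.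
      * simpl; rewrite E; now rewrite app_assoc.
      * rewrite length_app; fold (wdist (p l) (p (Datatypes.S l))).
        generalize (Hs l ltac:(lia)); lia.
Qed.

End WordMetric.

(** * Filling by short relations *)

Definition short_consequences {S} (Rel Rel' : word S -> Prop) (M : nat) : Prop :=
  forall r, (length r <= M)%nat -> weq Rel r nil -> weq Rel' r nil.

Lemma short_weq {S} {Rel Rel' : word S -> Prop} {M : nat} {u v : word S} :
  short_consequences Rel Rel' M -> (length u + length v <= M)%nat ->
  weq Rel u v -> weq Rel' u v.
Proof.
  intros Hs HM H; apply (weq_cancelr Rel' (winv v)).
  eapply weq_trans; [|apply weq_sym, weq_winvr].
  apply Hs; [rewrite length_app, length_winv; lia|].
  eapply weq_trans; [apply weq_appr, H|apply weq_winvr].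
Qed.

(* A word path fellow-travelling the sequence [p] is filled against [p] by
   quadrilaterals of bounded perimeter. *)
Lemma fellow_travel {S} (Rel Rel' : word S -> Prop) (p : nat -> word S) (K D : nat)
  (s : word S) :
  short_consequences Rel Rel' (8 * D + 30) ->
  (wdist Rel nil (p 0%nat) <= 3)%nat ->
  (forall k, (k < K)%nat -> (wdist Rel (p k) (p (Datatypes.S k)) <= 3)%nat) ->
  (forall k l, (k <= l <= K)%nat -> (l - k <= wdist Rel (p k) (p l) + 3)%nat) ->
  (forall i, (i <= length s)%nat ->
     exists k, (k <= K)%nat /\ (wdist Rel (firstn i s) (p k) <= D)%nat) ->
  forall k c, (k <= K)%nat -> (length c <= D)%nat ->
    weq Rel (s ++ c) (p k) -> weq Rel' (s ++ c) (chain Rel p k).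
Proof.
  intros Hs H0 Hstep Hqi.
  (* The connecting word [c] stays universally quantified, so the induction hypothesis applies to
     the connector [c0] chosen at the shorter prefix. *)
  induction s as [|x s IH] using rev_ind; intros Hnear k c Hk Hc H.
  - simpl in *.
    assert (Hd : (wdist Rel nil (p k) <= D)%nat)
      by (eapply Nat.le_trans; [apply (wdist_le Rel nil (p k) c); auto|auto]).
    destruct (chain_split Rel p K 0 k Hstep ltac:(lia)) as [m [E Hm]].
    apply (short_weq Hs).
    + rewrite E, length_app; simpl; fold (wdist Rel nil (p 0%nat)).
      generalize (Hqi 0%nat k ltac:(lia)) (wdist_triangle Rel nil (p 0%nat) (p k)).
      rewrite (wdist_sym Rel (p 0%nat) nil); lia.
    + eapply weq_trans; [exact H|apply weq_sym, weq_chain].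
  - destruct (Hnear (length s)) as [k0 [Hk0 Hd0]]; [rewrite length_app; lia|].
    rewrite firstn_app, Nat.sub_diag, firstn_all in Hd0; simpl in Hd0.
    rewrite app_nil_r in Hd0.
    set (c0 := geo Rel s (p k0)).
    assert (Hc0 : (length c0 <= D)%nat) by exact Hd0.
    assert (H1 : weq Rel' (s ++ c0) (chain Rel p k0)).
    { apply IH; auto; [|apply weq_geo].
      intros i Hi; destruct (Hnear i) as [l Hl]; [rewrite length_app; lia|].
      rewrite firstn_app in Hl.
      replace (i - length s)%nat with 0%nat in Hl by lia.
      simpl in Hl; rewrite app_nil_r in Hl; eauto. }
    rewrite <- app_assoc in H |- *.
    (* With [Hqi] the indices differ by at most [2 * D + 4], so the stretch [m] of the chain between
       them has length at most [6 * D + 12]. Together with [c0], [x] and [c] the perimeter is at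
       most [8 * D + 13]. *)
    assert (Hd : (wdist Rel (p k0) (p k) <= 2 * D + 1)%nat).
    { apply (wdist_le Rel s (p k) ([x] ++ c)) in H; simpl in H.
      generalize (wdist_triangle Rel s (p k0) (p k)).
      rewrite (wdist_sym Rel (p k0) s); lia. }
    assert (HG : weq Rel (s ++ [x] ++ c) (chain Rel p k))
      by (eapply weq_trans; [exact H|apply weq_sym, weq_chain]).
    assert (HG0 : weq Rel (s ++ c0) (chain Rel p k0))
      by (eapply weq_trans; [apply weq_geo|apply weq_sym, weq_chain]).
    destruct (le_lt_dec k0 k) as [Hle|Hlt].
    + destruct (chain_split Rel p K k0 k Hstep ltac:(lia)) as [m [E Hm]].
      generalize (Hqi k0 k ltac:(lia)); intros Hq.
      rewrite E in HG |- *.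
      eapply weq_trans; [|apply weq_appr, H1].
      rewrite <- app_assoc; apply weq_appl, (short_weq Hs).
      * rewrite !length_app; simpl; lia.
      * apply (weq_cancell Rel s); eapply weq_trans; [exact HG|].
        apply weq_sym; rewrite app_assoc; now apply weq_appr.
    (* Now the chain to [k0] is the longer one, so [m] is appended to the side of [c] and cancelled
       afterwards. *)
    + destruct (chain_split Rel p K k k0 Hstep ltac:(lia)) as [m [E Hm]].
      generalize (Hqi k k0 ltac:(lia)); intros Hq.
      rewrite (wdist_sym Rel (p k) (p k0)) in Hq.
      rewrite E in H1, HG0.
      apply (weq_cancelr Rel' m).
      eapply weq_trans; [|exact H1].
      rewrite <- app_assoc; apply weq_appl, (short_weq Hs).
      * rewrite !length_app; simpl; lia.
      * apply (weq_cancell Rel s); apply weq_sym.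
        eapply weq_trans; [exact HG0|]; apply weq_sym.
        rewrite app_assoc; now apply weq_appr.
Qed.

(** * Comparing the metric graph with its vertices *)

(** As [real] sends infinite values to 0, both an element and a lower bound of [E] are needed to
    make the infimum finite, here and in [real_Glb_le]. *)
Lemma real_Glb_ge (E : R -> Prop) (m : R) :
  (exists x, E x) -> (forall x, E x -> m <= x) -> m <= real (Glb_Rbar E).
Proof.
  intros [x Ex] H; destruct (Glb_Rbar_correct E) as [Hl Hg].
  specialize (Hl x Ex); specialize (Hg (Finite m) H).
  destruct (Glb_Rbar E); simpl in *; tauto.
Qed.

Lemma real_Glb_le (E : R -> Prop) (m x : R) :
  (forall y, E y -> m <= y) -> E x -> real (Glb_Rbar E) <= x.
Proof.
  intros H Ex; destruct (Glb_Rbar_correct E) as [Hl Hg].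
  specialize (Hl x Ex); specialize (Hg (Finite m) H).
  destruct (Glb_Rbar E); simpl in *; tauto.
Qed.

Lemma vdist_wdist {S} (Rel : word S -> Prop) (u v : word S) :
  vdist Rel u v = INR (wdist Rel u v).
Proof.
  unfold vdist; apply Rle_antisym.
  - apply real_Glb_le with 0.
    + intros y [w [_ ->]]; apply pos_INR.
    + exists (geo Rel u v); split; auto using weq_geo.
  - apply real_Glb_ge.
    + exists (INR (wdist Rel u v)), (geo Rel u v); split; auto using weq_geo.
    + intros y [w [Hw ->]]; apply le_INR; now apply wdist_le.
Qed.

Definition base {S} (p : Pt S) : word S :=
  match p with PV g => g | PE g _ _ => g end.

Lemma In_anchors {S} (Rel : word S -> Prop) (p : Pt S) (a : word S) (x : R) :
  In (a, x) (anchors p) -> 0 <= x <= 1 /\ (wdist Rel (base p) a <= 1)%nat.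
Proof.
  destruct p as [g|g s [t Ht]]; simpl.
  - intros [E|[]]; injection E; intros; subst.
    rewrite wdist_weq by apply weq_refl; split; [lra|lia].
  - intros [E|[E|[]]]; injection E; intros; subst; (split; [lra|]).
    + rewrite wdist_weq by apply weq_refl; lia.
    + apply wdist_letter.
Qed.

Lemma base_In_anchors {S} (p : Pt S) : exists x, In (base p, x) (anchors p).
Proof. destruct p; simpl; eauto. Qed.

(* Comparing [dX] with [wdist] up to an additive error avoids proving that
   [dX] is a pseudometric. *)
Lemma dX_base {S} (Rel : word S -> Prop) (p q : Pt S) :
  INR (wdist Rel (base p) (base q)) - 2 <= dX Rel p q
    <= INR (wdist Rel (base p) (base q)) + 2.
Proof.
  destruct (base_In_anchors p) as [x Hx], (base_In_anchors q) as [y Hy].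
  (* This bound is used twice: for the lower estimate, and for the finiteness of the infimum in the
     upper one. *)
  assert (L : forall r,
    (exists a x b y, In (a, x) (anchors p) /\ In (b, y) (anchors q) /\
       r = x + vdist Rel a b + y) \/
    (exists g g' s t t', p = PE g s t /\ q = PE g' s t' /\ weq Rel g g' /\
       r = Rabs (proj1_sig t - proj1_sig t')) ->
    INR (wdist Rel (base p) (base q)) - 2 <= r).
  { intros r [[a [x' [b [y' [Ha [Hb ->]]]]]]|[g [g' [s [t [t' [-> [-> [Hw ->]]]]]]]]].
    - apply (In_anchors Rel) in Ha; apply (In_anchors Rel) in Hb.
      rewrite vdist_wdist.
      assert (H : (wdist Rel (base p) (base q) <= wdist Rel a b + 2)%nat).
      { generalize (wdist_triangle Rel a (base p) (base q))
          (wdist_triangle Rel b a (base q)).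
        rewrite (wdist_sym Rel b (base q)); lia. }
      apply le_INR in H; rewrite plus_INR in H; simpl in H; lra.
    - simpl; rewrite wdist_weq by auto; simpl.
      generalize (Rabs_pos (proj1_sig t - proj1_sig t')); lra. }
  unfold dX; split.
  - apply real_Glb_ge; auto.
    eexists; left; exists (base p), x, (base q), y; split; [auto|split; [auto|reflexivity]].
  - apply Rle_trans with (x + vdist Rel (base p) (base q) + y).
    + eapply real_Glb_le; [exact L|].
      left; exists (base p), x, (base q), y; auto.
    + rewrite vdist_wdist.
      apply (In_anchors Rel) in Hx; apply (In_anchors Rel) in Hy; lra.
Qed.

(** * Quasi-geodesic words in the metric graph and their Morse shadows *)

Definition nat_floor (t : R) : nat :=
  match Rle_dec 0 t with
  | left h => proj1_sig (nfloor_ex t h)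
  | right _ => 0%nat
  end.

Lemma nat_floor_spec (t : R) : 0 <= t -> INR (nat_floor t) <= t < INR (nat_floor t) + 1.
Proof.
  intros H; unfold nat_floor; destruct Rle_dec; [|tauto].
  destruct nfloor_ex; simpl; lra.
Qed.

Lemma INR_lt_1 (m n : nat) : INR m < INR n + 1 -> (m <= n)%nat.
Proof. rewrite <- S_INR; intros H; apply INR_lt in H; lia. Qed.

(* The endpoints of a quasi-geodesic must lie exactly on the Morse geodesic,
   so the first and last values are replaced by its endpoints. *)
Definition step_path {S} (s : word S) (p q : Pt S) (t : R) : Pt S :=
  if Req_dec_T t 0 then p
  else if Req_dec_T t (INR (length s) + 1) then q
  else PV (firstn (nat_floor t) s).

Lemma step_path_near {S} (Rel : word S -> Prop) (s : word S) (p q : Pt S) (t : R) :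
  (wdist Rel nil (base p) <= 3)%nat -> (wdist Rel s (base q) <= 3)%nat ->
  0 <= t <= INR (length s) + 1 ->
  exists i, (i <= length s)%nat /\ INR i <= t <= INR i + 1 /\
    (wdist Rel (firstn i s) (base (step_path s p q t)) <= 3)%nat.
Proof.
  intros Hp Hq Ht; unfold step_path; destruct Req_dec_T as [->|H0].
  - exists 0%nat; simpl; split; [lia|split; [lra|auto]].
  - destruct Req_dec_T as [->|H1].
    + exists (length s); rewrite firstn_all; split; [lia|split; [lra|auto]].
    + generalize (nat_floor_spec t ltac:(lra)); intros Hf.
      exists (nat_floor t); split; [apply INR_lt_1; lra|split; [lra|]].
      simpl; rewrite wdist_weq by apply weq_refl; lia.
Qed.

(** Changing the two end values costs 6, rounding the times costs 1, and passing between [dX] and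
    [wdist] costs 2. Writing [T] for [Rabs (t - t')], the distance lies between [(T - 31) / 3] and
    [T + 9], which the constants 3 and 20 cover. *)
Lemma step_path_quasi_geodesic {S} (Rel : word S -> Prop) (s : word S) (p q : Pt S) :
  quasi Rel s ->
  (wdist Rel nil (base p) <= 3)%nat -> (wdist Rel s (base q) <= 3)%nat ->
  quasi_geodesic (dX Rel) 3 20 0 (INR (length s) + 1) (step_path s p q).
Proof.
  intros Hs Hp Hq; split; [generalize (pos_INR (length s)); lra|].
  intros t t' Ht Ht'.
  destruct (step_path_near Rel s p q t Hp Hq Ht) as [i [Hi [Hti Hwi]]].
  destruct (step_path_near Rel s p q t' Hp Hq Ht') as [j [Hj [Htj Hwj]]].
  generalize (dX_base Rel (step_path s p q t) (step_path s p q t')).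
  set (a := base (step_path s p q t)) in *.
  set (b := base (step_path s p q t')) in *.
  set (u := firstn i s) in *; set (v := firstn j s) in *.
  assert (H1 : (wdist Rel a b <= wdist Rel u v + 6)%nat).
  { generalize (wdist_triangle Rel u a b) (wdist_triangle Rel v u b).
    rewrite (wdist_sym Rel a u); lia. }
  assert (H2 : (wdist Rel u v <= wdist Rel a b + 6)%nat).
  { generalize (wdist_triangle Rel a u v) (wdist_triangle Rel b a v).
    rewrite (wdist_sym Rel b v); lia. }
  assert (H3 : (wdist Rel u v <= j - i + (i - j))%nat /\
               (j - i + (i - j) <= 3 * wdist Rel u v + 6)%nat).
  { destruct (le_lt_dec i j).
    - generalize (wdist_firstn Rel i j s ltac:(lia)) (Hs i j ltac:(lia)).
      fold u v; lia.
    - rewrite (wdist_sym Rel u v).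
      generalize (wdist_firstn Rel j i s ltac:(lia)) (Hs j i ltac:(lia)).
      fold u v; lia. }
  assert (H4 : Rabs (t - t') - 1 <= INR (j - i + (i - j)) <= Rabs (t - t') + 1).
  { destruct (le_lt_dec i j) as [Hij|Hij].
    - replace (j - i + (i - j))%nat with (j - i)%nat by lia.
      rewrite minus_INR by lia; apply le_INR in Hij.
      unfold Rabs; destruct Rcase_abs; lra.
    - replace (j - i + (i - j))%nat with (i - j)%nat by lia.
      rewrite minus_INR by lia; apply lt_INR in Hij.
      unfold Rabs; destruct Rcase_abs; lra. }
  destruct H3 as [H3 H5]; set (m := (j - i + (i - j))%nat) in *.
  apply le_INR in H1, H2, H3, H5.
  rewrite plus_INR in H1, H2; rewrite plus_INR, mult_INR in H5; simpl in *.
  generalize (Rabs_pos (t - t')); lra.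
Qed.

(** The Morse property is applied to [step_path], whose ends are the ends of [g]. The additive 6
    consists of 3 from [step_path_near], 1 because its index may be one less than [i], and 2 from
    [dX_base]. *)
Lemma morse_shadow {S} (Rel : word S -> Prop) (N : R -> R -> R) (a b : R)
  (g : R -> Pt S) (s : word S) :
  geodesic (dX Rel) a b g -> N_Morse (dX Rel) N a b g ->
  quasi Rel s -> (wdist Rel nil (base (g a)) <= 3)%nat ->
  (wdist Rel s (base (g b)) <= 3)%nat ->
  forall i, (i <= length s)%nat -> exists t, a <= t <= b /\
    INR (wdist Rel (firstn i s) (base (g t))) <= N 3 20 + 6.
Proof.
  intros [Hab Hg] HM Hq Ha Hb i Hi.
  set (l := INR (length s) + 1).
  assert (Hil : 0 <= INR i <= l).
  { split; [apply pos_INR|]; unfold l; apply le_INR in Hi; lra. }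
  assert (E0 : step_path s (g a) (g b) 0 = g a).
  { unfold step_path; destruct Req_dec_T; tauto. }
  assert (E1 : step_path s (g a) (g b) l = g b).
  { unfold step_path; generalize (pos_INR (length s)); intros.
    destruct Req_dec_T as [E|]; [unfold l in E; lra|].
    destruct Req_dec_T as [|Hl]; auto; now elim Hl. }
  destruct (HM 3 20 ltac:(lra) ltac:(lra) 0 l (step_path s (g a) (g b))
    (step_path_quasi_geodesic Rel s _ _ Hq Ha Hb)) with (t := INR i) as [t [Ht Hd]]; auto.
  - rewrite E0; exists a; split; [lra|].
    rewrite Hg by lra; rewrite Rminus_diag; apply Rabs_R0.
  - rewrite E1; exists b; split; [lra|].
    rewrite Hg by lra; rewrite Rminus_diag; apply Rabs_R0.
  - exists t; split; auto.
    destruct (step_path_near Rel s _ _ _ Ha Hb Hil) as [j [Hj [Hij Hw]]].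
    generalize (dX_base Rel (step_path s (g a) (g b) (INR i)) (g t)).
    set (c := base (step_path s (g a) (g b) (INR i))) in *.
    intros Hc.
    assert (Hji : (j <= i <= j + 1)%nat).
    { destruct Hij as [H1 H2]; apply INR_le in H1.
      rewrite <- S_INR in H2; apply INR_le in H2; lia. }
    assert (H : (wdist Rel (firstn i s) (base (g t)) <= wdist Rel c (base (g t)) + 4)%nat).
    { generalize (wdist_firstn Rel j i s ltac:(lia))
        (wdist_triangle Rel (firstn j s) (firstn i s) (base (g t)))
        (wdist_triangle Rel c (firstn j s) (base (g t))).
      rewrite (wdist_sym Rel (firstn i s) (firstn j s)); lia. }
    apply le_INR in H; rewrite plus_INR in H; simpl in H; lra.
Qed.

(** * Bigons and triangles over the Morse stratum *)

(** Both words fellow-travel the same Morse geodesic, so [fellow_travel] compares each of them in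
    [Rel'] with the same chain along it. *)
Lemma morse_quasi_unique {S} (Rel Rel' : word S -> Prop) (N : R -> R -> R) (D : nat)
  (x : Pt S) (s s' : word S) :
  N 3 20 + 9 <= INR D ->
  short_consequences Rel Rel' (8 * D + 30) ->
  morse_stratum (dX Rel) N (PV nil) x ->
  quasi Rel s -> quasi Rel s' -> weq Rel s s' -> (wdist Rel s (base x) <= 1)%nat ->
  weq Rel' s s'.
Proof.
  intros HD Hshort [a [b [g [Hgeo [Ha [Hb HM]]]]]] Hs Hs' Hss Hx.
  assert (Ha' : (wdist Rel nil (base (g a)) <= 3)%nat).
  { generalize (dX_base Rel (g a) (PV nil)); rewrite Ha, wdist_sym; simpl.
    intros H; apply INR_le; simpl; lra. }
  assert (Hb' : (wdist Rel s (base (g b)) <= 3)%nat).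
  { generalize (dX_base Rel (g b) x); rewrite Hb; intros H.
    assert (H' : (wdist Rel (base (g b)) (base x) <= 2)%nat)
      by (apply INR_le; simpl; lra).
    generalize (wdist_triangle Rel (base x) s (base (g b))).
    rewrite (wdist_sym Rel (base x) (base (g b))); lia. }
  assert (Hb'' : (wdist Rel s' (base (g b)) <= 3)%nat).
  { rewrite <- (wdist_compat Rel s s' (base (g b)) (base (g b))); auto using weq_refl. }
  assert (Hgeo' := Hgeo); destruct Hgeo' as [Hab Hd].
  set (K := nat_floor (b - a)).
  assert (HK : INR K <= b - a < INR K + 1) by (apply nat_floor_spec; lra).
  (* The geodesic is sampled at unit time steps; by [dX_base] neighbouring samples are at word
     distance at most 1 + 2. *)
  set (p := fun k => base (g (a + INR k))).
  assert (HKle : forall k, (k <= K)%nat -> a <= a + INR k <= b).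
  { intros k Hk; apply le_INR in Hk; generalize (pos_INR k); lra. }
  assert (Hnear : forall r, quasi Rel r -> (wdist Rel r (base (g b)) <= 3)%nat ->
    forall i, (i <= length r)%nat ->
      exists k, (k <= K)%nat /\ (wdist Rel (firstn i r) (p k) <= D)%nat).
  { intros r Hr Hrb i Hi.
    destruct (morse_shadow Rel N a b g r Hgeo HM Hr Ha' Hrb i Hi) as [t [Ht Hw]].
    generalize (nat_floor_spec (t - a) ltac:(lra)); intros Hf.
    set (k := nat_floor (t - a)) in *.
    assert (Hk : (k <= K)%nat) by (apply INR_lt_1; lra).
    exists k; split; auto.
    (* Rounding the time down to a sample costs less than 1, and [dX_base] costs 2. Added to
       [N 3 20 + 6] this explains the bound [N 3 20 + 9] required of [D]. *)
    generalize (dX_base Rel (g t) (g (a + INR k))).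
    rewrite Hd, Rabs_pos_eq by (auto; lra); fold (p k); intros Hc.
    generalize (wdist_triangle Rel (base (g t)) (firstn i r) (p k)); intros H.
    apply INR_le; apply le_INR in H; rewrite plus_INR in H; lra. }
  assert (H0 : (wdist Rel nil (p 0%nat) <= 3)%nat).
  { unfold p; simpl; now rewrite Rplus_0_r. }
  assert (Hstep : forall k, (k < K)%nat ->
    (wdist Rel (p k) (p (Datatypes.S k)) <= 3)%nat).
  { intros k Hk.
    generalize (HKle k ltac:(lia)) (HKle (Datatypes.S k) ltac:(lia)); intros H1 H2.
    generalize (dX_base Rel (g (a + INR k)) (g (a + INR (Datatypes.S k)))).
    rewrite Hd by auto; fold (p k) (p (Datatypes.S k)).
    rewrite S_INR, Rabs_left1 by lra.
    intros H; apply INR_le; simpl; lra. }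
  assert (Hqi : forall k l, (k <= l <= K)%nat ->
    (l - k <= wdist Rel (p k) (p l) + 3)%nat).
  { intros k l Hkl.
    generalize (HKle k ltac:(lia)) (HKle l ltac:(lia)); intros H1 H2.
    assert (Hle : INR k <= INR l) by (apply le_INR; lia).
    generalize (dX_base Rel (g (a + INR k)) (g (a + INR l))).
    rewrite Hd by auto; fold (p k) (p l).
    rewrite Rabs_left1 by lra.
    intros H; apply INR_le; rewrite minus_INR, plus_INR by lia; simpl; lra. }
  destruct (Hnear s Hs Hb' (length s) (le_n _)) as [k [Hk Hw]].
  rewrite firstn_all in Hw.
  (* As [s] and [s'] agree in [Rel], the same connector [c] leads from both to [p k], and it cancels
     at the end. *)
  set (c := geo Rel s (p k)).
  apply (weq_cancelr Rel' c).
  apply weq_trans with (chain Rel p k).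
  - apply (fellow_travel Rel Rel' p K D); auto; apply weq_geo.
  - apply weq_sym, (fellow_travel Rel Rel' p K D); auto.
    eapply weq_trans; [apply weq_appr, weq_sym, Hss|apply weq_geo].
Qed.

(** Cutting [w] at its vertex [q] closest to the identity, and joining that vertex to the identity
    by [z], splits the triangle into two bigons. Each is closed in [Rel'] by
    [morse_quasi_unique]. *)
Lemma morse_triangle {S} (Rel Rel' : word S -> Prop) (N : R -> R -> R) (D : nat)
  (x y : Pt S) (u v w : word S) :
  N 3 20 + 9 <= INR D ->
  short_consequences Rel Rel' (8 * D + 30) ->
  morse_stratum (dX Rel) N (PV nil) x -> morse_stratum (dX Rel) N (PV nil) y ->
  (wdist Rel u (base x) <= 1)%nat -> (wdist Rel v (base y) <= 1)%nat ->
  geodesic_from Rel nil u -> geodesic_from Rel nil v -> geodesic_from Rel u w ->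
  weq Rel (u ++ w) v -> weq Rel' (u ++ w) v.
Proof.
  intros HD Hshort Hx Hy Hux Hvy Gu Gv Gw Huwv.
  assert (Hmin : exists k, (k <= length w)%nat /\ forall l, (l <= length w)%nat ->
    (wdist Rel nil (u ++ firstn k w) <= wdist Rel nil (u ++ firstn l w))%nat).
  { assert (H : exists n k, (k <= length w)%nat /\ wdist Rel nil (u ++ firstn k w) = n)
      by (exists (wdist Rel nil (u ++ firstn 0 w)), 0%nat; split; [lia|auto]).
    destruct (dec_inh_nat_subset_has_unique_least_element _ (fun n => classic _) H)
      as [n [[[k [Hk En]] Hm] _]].
    exists k; split; auto; intros l Hl; rewrite En; apply Hm; eauto. }
  destruct Hmin as [k [Hk Hmin]].
  set (q := u ++ firstn k w) in *.
  set (z := geo Rel nil q).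
  assert (Hz : weq Rel z q) by exact (weq_geo Rel nil q).
  assert (Gz : geodesic_from Rel nil z) by apply geodesic_from_geo.
  (* The words [z] and [q] name the same vertex, and being geodesic depends only on the vertex. *)
  assert (Gshift : forall r, geodesic_from Rel q r -> geodesic_from Rel z r).
  { unfold geodesic_from; intros r <-.
    apply wdist_compat; auto; now apply weq_appr. }
  set (w1 := winv (firstn k w)); set (w2 := skipn k w).
  assert (Q1 : quasi Rel (z ++ w1)).
  { apply quasi_closest; auto.
    - apply Gshift, geodesic_from_winv, geodesic_from_firstn; auto.
    - intros l Hl; unfold w1 in Hl.
      rewrite length_winv, length_firstn, Nat.min_l in Hl by auto.
      apply Nat.le_trans with (wdist Rel nil (u ++ firstn (k - l) w)).
      { change (length z) with (wdist Rel nil q); apply Hmin; lia. }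
      apply Nat.eq_le_incl, wdist_compat; [apply weq_refl|].
      eapply weq_trans; [|apply weq_appr, weq_sym, Hz].
      unfold q, w1.
      assert (E : firstn k w = firstn (k - l) w ++ skipn (k - l) (firstn k w)).
      { rewrite <- (firstn_skipn (k - l) (firstn k w)) at 1.
        rewrite firstn_firstn, Nat.min_l; auto; lia. }
      assert (El : length (skipn (k - l) (firstn k w)) = l).
      { rewrite length_skipn, length_firstn; lia. }
      set (r := skipn (k - l) (firstn k w)) in *.
      assert (Ei : firstn l (winv (firstn k w)) = winv r).
      { rewrite E; unfold winv; rewrite map_app, rev_app_distr; fold (winv r).
        rewrite firstn_app, length_winv, El, Nat.sub_diag; simpl.
        rewrite app_nil_r; apply firstn_all2; rewrite length_winv; lia. }
      rewrite Ei; apply weq_sym, weq_app_winv; rewrite E, app_assoc.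
      apply weq_refl. }
  assert (Q2 : quasi Rel (z ++ w2)).
  { apply quasi_closest; auto.
    - apply Gshift, geodesic_from_skipn; auto.
    - intros l Hl; unfold w2 in *; rewrite length_skipn in Hl.
      apply Nat.le_trans with (wdist Rel nil (u ++ firstn (k + l) w)).
      { change (length z) with (wdist Rel nil q); apply Hmin; lia. }
      apply Nat.eq_le_incl, wdist_compat; [apply weq_refl|].
      eapply weq_trans; [|apply weq_appr, weq_sym, Hz].
      unfold q; rewrite <- app_assoc.
      rewrite <- (firstn_skipn k w) at 1.
      rewrite firstn_app, length_firstn, Nat.min_l by lia.
      rewrite firstn_all2 by (rewrite length_firstn; lia).
      replace (k + l - k)%nat with l by lia; apply weq_refl. }
  assert (E1 : weq Rel' u (z ++ w1)).
  { apply (morse_quasi_unique Rel Rel' N D x); auto using quasi_geodesic_word.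
    apply weq_sym; eapply weq_trans; [apply weq_appr, Hz|].
    apply weq_app_winv, weq_refl. }
  assert (E2 : weq Rel' v (z ++ w2)).
  { apply (morse_quasi_unique Rel Rel' N D y); auto using quasi_geodesic_word.
    eapply weq_trans; [apply weq_sym, Huwv|].
    apply weq_sym; eapply weq_trans; [apply weq_appr, Hz|].
    unfold q, w2; rewrite <- app_assoc, firstn_skipn; apply weq_refl. }
  apply weq_sym in E1; apply weq_sym in E2.
  eapply weq_trans; [|exact E2].
  rewrite <- (firstn_skipn k w), app_assoc; apply weq_appr.
  (* As [w1] is the inverse of [firstn k w], the first bigon says that [u ++ firstn k w] equals [z]
     in [Rel']. *)
  apply weq_app_winv in E1; unfold w1 in E1; now rewrite winv_involutive in E1.
Qed.

(** * Short relations follow from finitely many edges *)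

Lemma weq_mono {S} (Rel Rel' : word S -> Prop) (u v : word S) :
  (forall r, Rel r -> Rel' r) -> weq Rel u v -> weq Rel' u v.
Proof.
  intros H W; induction W; eauto using weq_refl, weq_sym, weq_trans, weq_free, weq_rel.
Qed.

Lemma relators_mono {S} (G : LGraph S) (EP EP' : gE G -> Prop) (r : word S) :
  (forall e, EP e -> EP' e) -> relators G EP r -> relators G EP' r.
Proof.
  intros H [v [p [Hp [HF ->]]]]; exists v, p; split; auto; split; auto.
  eapply Forall_impl; [|exact HF]; simpl; auto.
Qed.

(** A derivation applies finitely many relators, each read along a closed path with finitely many
    edges. *)
Lemma weq_finite_support {S} (G : LGraph S) (EP : gE G -> Prop) (u v : word S) :
  weq (relators G EP) u v -> exists l, weq (relators G (fun e => In e l)) u v.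
Proof.
  intros W; induction W as [w|u v _ [l IH]|u v w _ [l IH] _ [l' IH']|u v x|u v r Hr].
  - exists nil; apply weq_refl.
  - exists l; now apply weq_sym.
  - exists (l ++ l'); apply weq_trans with v.
    + eapply weq_mono; [|exact IH]; intros r; apply relators_mono.
      intros; apply in_or_app; auto.
    + eapply weq_mono; [|exact IH']; intros r; apply relators_mono.
      intros; apply in_or_app; auto.
  - exists nil; apply weq_free.
  - destruct Hr as [a [p [Hp [_ ->]]]].
    exists (map fst p); apply weq_rel.
    exists a, p; split; auto; split; auto.
    apply Forall_forall; intros st Hst; now apply in_map.
Qed.

Lemma finite_short_words {S} (M : nat) :
  FiniteT S -> exists L : list (word S), forall w, (length w <= M)%nat -> In w L.
Proof.
  intros [ls Hls]; induction M as [|M [L HL]].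
  - exists [nil]; intros [|x w]; simpl; [auto|lia].
  - exists (nil :: flat_map (fun s => map (cons (s, true)) L ++ map (cons (s, false)) L) ls).
    intros [|[s b] w] Hw; [now left|right; simpl in Hw].
    apply in_flat_map; exists s; split; auto.
    apply in_or_app; destruct b; [left|right]; apply in_map, HL; lia.
Qed.

(** There are finitely many words of length at most [M]. Excluded middle tells which of them are
    trivial, and the edges supporting their derivations are collected. *)
Lemma finite_short_relations {S} (G : LGraph S) (EP : gE G -> Prop) (M : nat) :
  FiniteT S -> exists l,
    short_consequences (relators G EP) (relators G (fun e => In e l)) M.
Proof.
  intros HS; destruct (finite_short_words M HS) as [L HL].
  assert (H : exists l, forall r, In r L -> weq (relators G EP) r nil ->
    weq (relators G (fun e => In e l)) r nil).
  { clear HL; induction L as [|r L [l IH]].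
    - exists nil; intros r [].
    - destruct (classic (weq (relators G EP) r nil)) as [W|W].
      + destruct (weq_finite_support G EP r nil W) as [l' W'].
        exists (l' ++ l); intros r' [<-|Hr'] W''.
        * eapply weq_mono; [|exact W']; intros r'; apply relators_mono.
          intros; apply in_or_app; auto.
        * eapply weq_mono; [|exact (IH r' Hr' W'')]; intros r''; apply relators_mono.
          intros; apply in_or_app; auto.
      + exists l; intros r' [<-|Hr']; [tauto|auto]. }
  destruct H as [l Hl]; exists l; intros r Hr; auto.
Qed.

(** * The isometric embedding of the stratum *)

(** A vertex is lifted by reading a geodesic word of the original group in the new one. An edge
    keeps its label and parameter, so only its start is prescribed, and its end has to be compared
    with the lift of the original end. *)
Definition geodesic_rep {S} (Rel : word S -> Prop) (p : Pt S) : Pt S :=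
  match p with
  | PV g => PV (geo Rel nil g)
  | PE g s t => PE (geo Rel nil g) s t
  end.

Section GeodesicRep.
Context {S : Type} (Rel Rel' : word S -> Prop) (N : R -> R -> R) (D : nat).
Context (N_le_D : N 3 20 + 9 <= INR D).
Context (short : short_consequences Rel Rel' (8 * D + 30)).
Context (weaker : forall u v, weq Rel' u v -> weq Rel u v).

Let stratum := morse_stratum (dX Rel) N (PV nil).

(** A geodesic word followed by one letter is still quasi-geodesic, so [morse_quasi_unique] applies.
    The end of the edge need not lie in the stratum itself; being within 1 of [base x] suffices. *)
Lemma weq_geo_letter (x : Pt S) (g : word S) (s : S) (t : R) :
  stratum x -> In (g ++ [(s, true)], t) (anchors x) ->
  weq Rel' (geo Rel nil g ++ [(s, true)]) (geo Rel nil (g ++ [(s, true)])).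
Proof.
  intros Hx Hin; apply (In_anchors Rel) in Hin; destruct Hin as [_ Hin].
  assert (W : weq Rel (geo Rel nil g ++ [(s, true)]) (g ++ [(s, true)]))
    by exact (weq_appr Rel [(s, true)] (weq_geo Rel nil g)).
  apply (morse_quasi_unique Rel Rel' N D x); auto.
  - apply quasi_geodesic_letter, geodesic_from_geo.
  - apply quasi_geodesic_word, geodesic_from_geo.
  - eapply weq_trans; [exact W|].
    exact (weq_sym (weq_geo Rel nil (g ++ [(s, true)]))).
  - rewrite (wdist_compat Rel _ _ _ _ W (weq_refl _ _)); now rewrite wdist_sym.
Qed.

Lemma anchors_geodesic_rep (x : Pt S) (a : word S) (t : R) :
  stratum x -> In (a, t) (anchors x) ->
  exists a', In (a', t) (anchors (geodesic_rep Rel x)) /\ weq Rel' a' (geo Rel nil a).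
Proof.
  intros Hx Hin; destruct x as [g|g s r]; simpl in Hin.
  - destruct Hin as [E|[]]; injection E; intros; subst.
    eexists; split; [now left|apply weq_refl].
  - destruct Hin as [E|[E|[]]]; injection E; intros; subst.
    + eexists; split; [now left|apply weq_refl].
    + eexists; split; [right; now left|].
      eapply weq_geo_letter; [exact Hx|right; now left].
Qed.

Lemma geodesic_rep_anchors (x : Pt S) (a' : word S) (t : R) :
  stratum x -> In (a', t) (anchors (geodesic_rep Rel x)) ->
  exists a, In (a, t) (anchors x) /\ weq Rel' a' (geo Rel nil a).
Proof.
  intros Hx Hin; destruct x as [g|g s r]; simpl in Hin.
  - destruct Hin as [E|[]]; injection E; intros; subst.
    eexists; split; [now left|apply weq_refl].
  - destruct Hin as [E|[E|[]]]; injection E; intros; subst.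
    + eexists; split; [now left|apply weq_refl].
    + eexists; split; [right; now left|].
      eapply weq_geo_letter; [exact Hx|right; now left].
Qed.

Lemma weq_geo_stratum (x y : Pt S) (a b w : word S) (t t' : R) :
  stratum x -> stratum y -> In (a, t) (anchors x) -> In (b, t') (anchors y) ->
  weq Rel (a ++ w) b -> length w = wdist Rel a b ->
  weq Rel' (geo Rel nil a ++ w) (geo Rel nil b).
Proof.
  intros Hx Hy Ha Hb W Hw.
  apply (In_anchors Rel) in Ha; apply (In_anchors Rel) in Hb.
  assert (Wa : weq Rel (geo Rel nil a) a) by exact (weq_geo Rel nil a).
  assert (Wb : weq Rel (geo Rel nil b) b) by exact (weq_geo Rel nil b).
  assert (Wab : weq Rel (geo Rel nil a ++ w) b)
    by (eapply weq_trans; [apply weq_appr, Wa|exact W]).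
  apply (morse_triangle Rel Rel' N D x y); auto using geodesic_from_geo.
  - rewrite (wdist_compat Rel _ _ _ _ Wa (weq_refl _ _)), wdist_sym; tauto.
  - rewrite (wdist_compat Rel _ _ _ _ Wb (weq_refl _ _)), wdist_sym; tauto.
  - unfold geodesic_from; rewrite Hw; now apply wdist_compat.
  - eapply weq_trans; [exact Wab|now apply weq_sym].
Qed.

(** Distances do not grow, because a geodesic word from [a] to [b] still joins the lifts by the
    triangle argument. They do not shrink, because every equality of [Rel'] holds in [Rel]. *)
Lemma vdist_geodesic_rep (x y : Pt S) (a b a' b' : word S) (t t' : R) :
  stratum x -> stratum y -> In (a, t) (anchors x) -> In (b, t') (anchors y) ->
  weq Rel' a' (geo Rel nil a) -> weq Rel' b' (geo Rel nil b) ->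
  vdist Rel' a' b' = vdist Rel a b.
Proof.
  intros Hx Hy Ha Hb Wa Wb; rewrite !vdist_wdist; f_equal; apply Nat.le_antisymm.
  - apply (wdist_le Rel' a' b' (geo Rel a b)).
    eapply weq_trans; [apply weq_appr, Wa|].
    eapply weq_trans; [|apply weq_sym, Wb].
    exact (weq_geo_stratum x y a b _ t t' Hx Hy Ha Hb (weq_geo Rel a b) eq_refl).
  - apply (wdist_le Rel a b (geo Rel' a' b')).
    apply weq_trans with (a' ++ geo Rel' a' b').
    + apply weq_appr, weq_sym; eapply weq_trans; [apply weaker, Wa|].
      exact (weq_geo Rel nil a).
    + eapply weq_trans; [apply weaker, weq_geo|].
      eapply weq_trans; [apply weaker, Wb|exact (weq_geo Rel nil b)].
Qed.

Lemma dX_geodesic_rep (x y : Pt S) :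
  stratum x -> stratum y ->
  dX Rel' (geodesic_rep Rel x) (geodesic_rep Rel y) = dX Rel x y.
Proof.
  intros Hx Hy; unfold dX; f_equal; apply Glb_Rbar_eqset; intros r; split.
  - intros [[a' [t [b' [t' [Ha [Hb ->]]]]]]|[g [g' [s [t [t' [Ex [Ey [W ->]]]]]]]]].
    + apply geodesic_rep_anchors in Ha; auto; destruct Ha as [a [Ha Wa]].
      apply geodesic_rep_anchors in Hb; auto; destruct Hb as [b [Hb Wb]].
      left; exists a, t, b, t'; split; [auto|split; [auto|]].
      now rewrite (vdist_geodesic_rep x y a b a' b' t t').
    + destruct x as [|h s0 r0]; [discriminate|]; destruct y as [|k s1 r1]; [discriminate|].
      simpl in Ex, Ey; injection Ex; injection Ey; intros; subst.
      right; exists h, k, s, t, t'; do 2 (split; [reflexivity|]); split; auto.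
      eapply weq_trans; [exact (weq_sym (weq_geo Rel nil h))|].
      eapply weq_trans; [exact (weaker _ _ W)|exact (weq_geo Rel nil k)].
  - intros [[a [t [b [t' [Ha [Hb ->]]]]]]|[g [g' [s [t [t' [-> [-> [W ->]]]]]]]]].
    + destruct (anchors_geodesic_rep x a t Hx Ha) as [a' [Ha' Wa]].
      destruct (anchors_geodesic_rep y b t' Hy Hb) as [b' [Hb' Wb]].
      left; exists a', t, b', t'; split; [auto|split; [auto|]].
      now rewrite (vdist_geodesic_rep x y a b a' b' t t').
    (* The two starts agree in [Rel], but their chosen geodesic words may differ; the triangle
       argument with an empty third side identifies them in [Rel']. *)
    + right; exists (geo Rel nil g), (geo Rel nil g'), s, t, t'.
      do 2 (split; [reflexivity|]); split; auto.
      rewrite <- (app_nil_r (geo Rel nil g)).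
      eapply weq_geo_stratum; [exact Hx|exact Hy|now left|now left| |].
      * now rewrite app_nil_r.
      * now rewrite wdist_weq.
Qed.

End GeodesicRep.

Theorem theorem7p7 (S I : Type) (Gam : I -> LGraph S)
  (HS : FiniteT S)
  (Hfin : forall i, FiniteT (gV (Gam i)) /\ FiniteT (gE (Gam i)))
  (Hconn : forall i, connected (Gam i))
  (HC : C'16 (union Gam))
  (Hgd : exists delta, 0 < delta /\
           forall i g D, is_girth (Gam i) g -> is_diam (Gam i) D -> delta * INR D <= INR g) :
  forall N : R -> R -> R, morse_gauge N ->
  exists (EP : gE (union Gam) -> Prop) (VP : gV (union Gam) -> Prop),
    finite_subgraph (union Gam) EP VP /\
    exists f : Pt S -> Pt S,
      isometric_embedding_on
        (dX (relators (union Gam) (fun _ => True)))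
        (dX (relators (union Gam) EP))
        (morse_stratum (dX (relators (union Gam) (fun _ => True))) N (PV nil))
        f.
Proof.
  intros N HN; set (G := union Gam).
  destruct (nfloor_ex (N 3 20)) as [n Hn]; [apply HN|].
  (* Since [N 3 20 < n + 1], adding 9 more gives the required bound. *)
  set (D := (n + 10)%nat).
  assert (HD : N 3 20 + 9 <= INR D) by (unfold D; rewrite plus_INR; simpl; lra).
  destruct (finite_short_relations G (fun _ => True) (8 * D + 30) HS) as [l Hl].
  (* The subgraph consists of the edges supporting the short relations, together with their
     endpoints. *)
  exists (fun e => In e l), (fun v => In v (map (gsrc G) l ++ map (gtgt G) l)).
  split.
  - split; [exists l; auto|split; [eexists; intros v Hv; exact Hv|]].
    intros e He; split; apply in_or_app; [left|right]; now apply in_map.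
  - exists (geodesic_rep (relators G (fun _ => True))); intros x y Hx Hy.
    apply (dX_geodesic_rep _ _ N D HD Hl); auto.
    intros u v; apply weq_mono; intros r; now apply relators_mono.
Qed.
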